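(* Let $A\subseteq\omega$ be an infinite c.e. set. Every countable partially ordered set can be isomorphically embedded into the Rogers semi-lattice of computable numberings of $\mathcal S^{(1)}_A$; that is, for every countable partially ordered set $(P,\le_P)$ there is an injective map $J$ from $P$ into the set $[\mathrm{BN}_A]$ of $m$-equivalence classes of computable numberings of $\mathcal S^{(1)}_A$ such that for all $p,q\in P$: $p\le_P q$ if and only if $J(p)\le J(q)$.
   Context: $\omega$ is the set of natural numbers; $\mathcal R^{(n)}$ is the set of total computable functions $\omega^n\to\omega$. $\langle\cdot,\cdot\rangle:\omega^2\to\omega$ is a computable bijection with $\langle x,y\rangle\ge x,y$. $\mathrm{Anf}^{(1)}_A$ is the set of partial functions from $\omega$ to $\omega$ whose domain is either empty or equal to $\{0,\dots,a-1\}$ for some $a\in A$, and $\mathcal S^{(1)}_A=\mathcal R^{(1)}\cup\mathrm{Anf}^{(1)}_A$. A numbering of a set $X$ is a surjection $\omega\to X$. A numbering $\eta$ of $\mathcal S^{(1)}_A$ is computable if it satisfies (QGN I): the extended graph $\{\langle\langle i,x\rangle,0\rangle:i,x\in\omega\}\cup\{\langle\langle i,x\rangle,\eta_i(x)+1\rangle:x\in\mathrm{dom}(\eta_i)\}$ of its universal function $(i,x)\mapsto\eta_i(x)$ is the range of a function in $\mathcal R^{(1)}$ (equivalently, the universal function is partial computable). $\mathrm{BN}_A$ is the set of computable numberings of $\mathcal S^{(1)}_A$. For numberings $\eta,\gamma$ of $\mathcal S^{(1)}_A$, $\eta\le_m\gamma$ means $\eta=\gamma\circ g$ for some $g\in\mathcal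 R^{(1)}$, and $\eta,\gamma$ are $m$-equivalent if $\eta\le_m\gamma$ and $\gamma\le_m\eta$; $[\eta]$ is the $m$-equivalence class of $\eta$, and $[\eta]\le[\gamma]$ iff $\eta\le_m\gamma$. The Rogers semi-lattice of computable numberings of $\mathcal S^{(1)}_A$ is the set $[\mathrm{BN}_A]$ of $m$-equivalence classes of elements of $\mathrm{BN}_A$ with this partial order. *)

(* Defs.v *)
From mathcomp Require Import all_boot all_order.
From mathcomp Require Import all_classical.

Set Implicit Arguments.
Unset Strict Implicit.
Unset Printing Implicit Defensive.

Local Open Scope classical_set_scope.

(* Kleene's mu-recursive functions. Codes carry no arity: a code denotes a
   partial function of every arity, an absent argument being read as 0. This
   does not change which functions of a given arity are partial recursive. *)
Inductive code : Type :=
| Zero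
| Succ
| Proj of nat
| Comp of code & seq code
| Prec of code & code
| Mu of code.

(* [eval c v y]: the function denoted by [c] is defined at [v], with value [y].
   Prec g h is f with f(0, v) = g(v) and f(n+1, v) = h(n, f(n, v), v);
   (Mu f)(v) is the least y with f(y, v) = 0, where f(z, v) must be defined
   for all z < y. *)
Fixpoint eval (c : code) (v : seq nat) (y : nat) {struct c} : Prop :=
  match c with
  | Zero => y = 0
  | Succ => y = (nth 0 v 0).+1
  | Proj i => y = nth 0 v i
  | Comp f gs =>
      exists2 ws : seq nat,
        (fix evals (gs : seq code) (ws : seq nat) {struct gs} : Prop :=
           match gs, ws with
           | [::], [::] => True
           | g :: gs', w :: ws' => eval g v w /\ evals gs' ws'
           | _, _ => False
           end) gs ws
        & eval f ws y
  | Prec g h =>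
      (fix prec (n y : nat) {struct n} : Prop :=
         match n with
         | 0 => eval g (behead v) y
         | n'.+1 => exists2 z : nat,
             prec n' z & eval h (n' :: z :: behead v) y
         end) (nth 0 v 0) y
  | Mu f =>
      eval f (y :: v) 0 /\
      forall z : nat, z < y -> exists w : nat, eval f (z :: v) w.+1
  end.

Definition total_computable (n : nat) : set (n.-tuple nat -> nat) :=
  [set f | exists c : code, forall (v : n.-tuple nat) (y : nat),
             eval c v y <-> y = f v].

Definition R1 : set (nat -> nat) :=
  [set f | @total_computable 1 (fun v => f (nth 0 v 0))].

Definition R2 : set (nat -> nat -> nat) :=
  [set f | @total_computable 2 (fun v => f (nth 0 v 0) (nth 0 v 1))].

Definition ce (A : set nat) : Prop :=
  A = set0 \/ exists2 f : nat -> nat, R1 f & range f = A.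

Definition pairing (pr : nat -> nat -> nat) : Prop :=
  [/\ R2 pr,
      bijective (fun p : nat * nat => pr p.1 p.2)
    & forall x y : nat, x <= pr x y /\ y <= pr x y].

Definition pfun : Type := nat -> option nat.

Definition dom (f : pfun) : set nat := [set x | f x <> None].

(* `I_a is the set {0, ..., a-1}. *)
Definition Anf (A : set nat) : set pfun :=
  [set f | dom f = set0 \/ exists2 a : nat, A a & dom f = `I_a].

Definition S1 (A : set nat) : set pfun :=
  [set (fun x => Some (f x)) | f in R1] `|` Anf A.

Definition numbering (X : set pfun) : set (nat -> pfun) :=
  [set eta | range eta = X].

Definition ext_graph (pr : nat -> nat -> nat) (eta : nat -> pfun) : set nat :=
  [set z | exists i x : nat, z = pr (pr i x) 0] `|`
  [set z | exists i x y : nat, eta i x = Some y /\ z = pr (pr i x) y.+1].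

Definition QGN1 (pr : nat -> nat -> nat) (eta : nat -> pfun) : Prop :=
  exists2 f : nat -> nat, R1 f & range f = ext_graph pr eta.

Definition BN (pr : nat -> nat -> nat) (A : set nat) : set (nat -> pfun) :=
  [set eta | numbering (S1 A) eta /\ QGN1 pr eta].

Definition m_le (eta gamma : nat -> pfun) : Prop :=
  exists2 g : nat -> nat, R1 g & eta = gamma \o g.

Definition m_class (A : set nat) (eta : nat -> pfun) : set (nat -> pfun) :=
  [set gamma | numbering (S1 A) gamma /\ m_le eta gamma /\ m_le gamma eta].

Definition Rogers (pr : nat -> nat -> nat) (A : set nat) :
    set (set (nat -> pfun)) :=
  [set m_class A eta | eta in BN pr A].

(* Independent of the representatives, see [class_leE]. *)
Definition class_le (X Y : set (nat -> pfun)) : Prop :=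
  exists eta gamma : nat -> pfun, [/\ X eta, Y gamma & m_le eta gamma].

Lemma R1_id : R1 id.
Proof. by exists (Proj 0) => v y. Qed.

Lemma R1_comp (f g : nat -> nat) : R1 f -> R1 g -> R1 (f \o g).
Proof.
move=> [c hc] [d hd]; exists (Comp c [:: d]) => v y; split=> /=.
- case=> ws; case: ws => [|w [|w' ws]]; [by case| |by case].
  by case=> /hd -> _ /(hc [tuple g (nth 0 v 0)]).
- move=> ->; exists [:: g (nth 0 v 0)]; first by split=> //; apply/hd.
  exact/(hc [tuple g (nth 0 v 0)]).
Qed.

Lemma m_le_refl (eta : nat -> pfun) : m_le eta eta.
Proof. by exists id => //; exact: R1_id. Qed.

Lemma m_le_trans (eta gamma delta : nat -> pfun) :
  m_le eta gamma -> m_le gamma delta -> m_le eta delta.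
Proof.
by move=> [f hf ->] [g hg ->]; exists (g \o f) => //; exact: R1_comp.
Qed.

Lemma class_leE (A : set nat) (eta gamma : nat -> pfun) :
  numbering (S1 A) eta -> numbering (S1 A) gamma ->
  class_le (m_class A eta) (m_class A gamma) <-> m_le eta gamma.
Proof.
move=> he hg; split=> [[e [g [[_ [h1 _]] [_ [_ h2]] h]]]|h].
  exact: m_le_trans h1 (m_le_trans h h2).
by exists eta, gamma; split=> //; split=> //; split; exact: m_le_refl.
Qed.

(* Main.v *)
(* From a machine computing every partial recursive function one gets a computable
   numbering [beta] of the nonempty functions of S_A: truncate the domain of the
   e-th function to the union of the segments of length in A on which it is seen
   to converge, and start enumerating only when the result is known to be
   nonempty. By diagonalization K = {j | beta_j(j) = 0} is undecidable.
   For a decidable set r let [eta r] be the join of [beta] with numberings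
   gamma_x of {empty, constant x} for all x in r, where gamma_x(j) is the
   constant x if j is in K, and is empty otherwise. Then [eta r] reduces to
   [eta r'] iff r is contained in r': if x is in r but not in r', then a value
   constant x can only be reached in the [beta] part and an empty one only
   outside of it, so a reduction would decide K. Finally, every countable
   preorder embeds into the decidable sets ordered by inclusion. *)

Require Import Defs.
From mathcomp Require Import all_boot all_order all_classical.

Set Implicit Arguments.
Unset Strict Implicit.
Unset Printing Implicit Defensive.

Local Open Scope classical_set_scope.

(** * Closure properties of computable functions *)

(** Plain lists, with the length fixed only at evaluation, let arguments be dropped or prepended
    without casts between tuple types. *)
Definition computable k (f : seq nat -> nat) : Prop :=
  exists c : code, forall v, size v = k -> forall y, eval c v y <-> y = f v.

Lemma total_computableE k (f : seq nat -> nat) :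
  @total_computable k (fun v => f v) <-> computable k f.
Proof.
split=> -[c hc]; exists c; last by move=> v; apply: hc; rewrite size_tuple.
by move=> v /eqP sv; apply: (hc (Tuple sv)).
Qed.

Lemma R1E (f : nat -> nat) : R1 f <-> computable 1 (fun v => f (nth 0 v 0)).
Proof. exact: (@total_computableE 1 (fun v => f (nth 0 v 0))). Qed.

Definition computableb k (b : seq nat -> bool) := computable k (fun v => b v).

Lemma computable_ext k (f g : seq nat -> nat) :
  f =1 g -> computable k f -> computable k g.
Proof. by move=> /funext ->. Qed.

Lemma computable_nth k i : computable k (fun v => nth 0 v i).
Proof. by exists (Proj i). Qed.

Lemma computable_comp k m (f : seq nat -> nat) (g : nat -> seq nat -> nat) :
  computable m f -> (forall i, i < m -> computable k (g i)) ->
  computable k (fun v => f (mkseq (g ^~ v) m)).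
Proof.
(* [evals] restates the anonymous inner fixpoint of [eval], so that the codes for the [g i] can be
   collected by induction on the list of indices. *)
move=> [c hc] hg; pose evals v := fix evals (gs : seq code) (ws : seq nat) :=
  match gs, ws with
  | [::], [::] => True
  | g :: gs', w :: ws' => eval g v w /\ evals gs' ws'
  | _, _ => False
  end.
have [cs hcs] : exists cs, forall v, size v = k ->
    forall ws, evals v cs ws <-> ws = mkseq (g ^~ v) m.
  rewrite /mkseq; have : {in iota 0 m, forall i, computable k (g i)}.
    by move=> i; rewrite mem_iota; exact: hg.
  elim: (iota 0 m) => [|i s IH] gs.
    by exists [::] => v sv [|w ws] //=; split.
  have [cs hcs] := IH (fun j js => gs j (mem_behead (s := i :: s) js)).
  have [e he] := gs i (mem_head i s).
  exists (e :: cs) => v sv [|w ws] /=; first by split.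
  by split=> [[/(he _ sv) -> /(hcs _ sv) ->]//|[-> ->]]; split; [exact/he|exact/hcs].
exists (Comp c cs) => v sv y; split=> /=.
  by case=> ws /(hcs _ sv) -> /hc; apply; rewrite size_mkseq.
move=> ->; exists (mkseq (g ^~ v) m); first exact/hcs.
by apply/hc; rewrite ?size_mkseq.
Qed.

Lemma computable_comp1 k (h : nat -> nat) f : R1 h ->
  computable k f -> computable k (fun v => h (f v)).
Proof.
move=> /R1E hh hf; apply: (computable_comp (g := nth f [::]) hh) => i _.
by rewrite nth_nil.
Qed.

Lemma computable_comp2 k (h : nat -> nat -> nat) f g :
  computable 2 (fun v => h (nth 0 v 0) (nth 0 v 1)) ->
  computable k f -> computable k g -> computable k (fun v => h (f v) (g v)).
Proof.
by move=> hh hf hg; apply: (computable_comp (g := nth f [:: f; g]) hh) => -[|[]].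
Qed.

Lemma computable_comp3 k (h : nat -> nat -> nat -> nat) f1 f2 f3 :
  computable 3 (fun v => h (nth 0 v 0) (nth 0 v 1) (nth 0 v 2)) ->
  computable k f1 -> computable k f2 -> computable k f3 ->
  computable k (fun v => h (f1 v) (f2 v) (f3 v)).
Proof.
move=> hh h1 h2 h3; apply: (computable_comp (g := nth f1 [:: f1; f2; f3]) hh).
by move=> [|[|[]]].
Qed.

Lemma computable_comp4 k (h : nat -> nat -> nat -> nat -> nat) f1 f2 f3 f4 :
  computable 4 (fun v => h (nth 0 v 0) (nth 0 v 1) (nth 0 v 2) (nth 0 v 3)) ->
  computable k f1 -> computable k f2 -> computable k f3 -> computable k f4 ->
  computable k (fun v => h (f1 v) (f2 v) (f3 v) (f4 v)).
Proof.
move=> hh h1 h2 h3 h4.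
apply: (computable_comp (g := nth f1 [:: f1; f2; f3; f4]) hh).
by move=> [|[|[|[]]]].
Qed.

(** Composition for an explicit argument list; it serves to drop, insert and reorder arguments. *)
Lemma computable_args k m f (g : nat -> seq nat -> nat) (w : seq nat -> seq nat) :
  (forall v, size v = k -> size (w v) = m) ->
  (forall v i, i < m -> nth 0 (w v) i = g i v) ->
  (forall i, i < m -> computable k (g i)) ->
  computable m f -> computable k (fun v => f (w v)).
Proof.
move=> sw wg hg hf; have [c hc] := computable_comp hf hg.
exists c => v sv y; rewrite (hc v sv); suff -> : w v = mkseq (g ^~ v) m by [].
apply: (@eq_from_nth _ 0) => [|i]; rewrite sw ?size_mkseq// => im.
by rewrite nth_mkseq// wg.
Qed.

Lemma computable_succ k f : computable k f -> computable k (fun v => (f v).+1).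
Proof. by apply: computable_comp1; exists Succ. Qed.

Lemma computable_const k m : computable k (fun=> m).
Proof. by elim: m => [|m /computable_succ//]; exists Zero. Qed.

Lemma computable_behead k f : computable k f ->
  computable k.+1 (fun v => f (behead v)).
Proof.
apply: (computable_args (g := fun i v => nth 0 v i.+1)) 
  => [[]//= _ v []//|v i _|i _].
  exact: nth_behead.
exact: computable_nth.
Qed.

Lemma computable_cons k n f : computable k n -> computable k.+1 f ->
  computable k (fun v => f (n v :: v)).
Proof.
move=> hn.
apply: (computable_args (g := fun i v => if i is j.+1 then nth 0 v j else n v)).
- by move=> v /= ->.
- by move=> v [].
- by move=> [|i] _ //; exact: computable_nth.
Qed.

Lemma computable_nth_behead k i : computable k (fun v => nth 0 (behead v) i).
Proof.
by apply: computable_ext (computable_nth k i.+1) => v; rewrite nth_behead.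
Qed.

Lemma computable_nth_behead2 k i :
  computable k (fun v => nth 0 (behead (behead v)) i).
Proof.
by apply: computable_ext (computable_nth k i.+2) => v; rewrite !nth_behead.
Qed.

Lemma computable_rec k n b (s : nat -> nat -> seq nat -> nat) :
  computable k n -> computable k b ->
  computable k.+2 (fun u => s (nth 0 u 0) (nth 0 u 1) (behead (behead u))) ->
  computable k (fun v => nat_rect (fun=> nat) (b v) (fun i z => s i z v) (n v)).
Proof.
move=> hn [g hg] [h hh].
(* [Prec] recurses on the head of its arguments, so [r] reads the bound there; prepending [n v] then
   gives the claim. *)
pose r v := nat_rect (fun=> nat) (b (behead v))
  (fun i z => s i z (behead v)) (nth 0 v 0).
have hr : computable k.+1 r.
  exists (Prec g h) => -[//|m v] /= [sv] y; rewrite /r /=.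
  elim: m y => [|m IH] y /=; first exact: hg.
  split; first by case=> z /IH -> /hh; rewrite /= sv => ->.
  by move=> ->; exists (r (m :: v)); [exact/IH|apply/hh; rewrite /= ?sv].
exact: computable_cons hn hr.
Qed.

Lemma computable_mu k (p : nat -> seq nat -> bool) (m : seq nat -> nat) :
  computableb k.+1 (fun u => p (nth 0 u 0) (behead u)) ->
  (forall v, p (m v) v) -> (forall v z, z < m v -> ~~ p z v) ->
  computable k m.
Proof.
move=> hp pm ltm.
(* [Mu] searches for a zero, hence the negation of [p]. *)
have [h hh] : computable k.+1 (fun u => ~~ p (nth 0 u 0) (behead u)).
  apply: computable_ext (computable_rec (s := fun _ _ _ => 0) hp
    (computable_const _ 1) (computable_const _ 0)) => u.
  by case: (p _ _).
exists (Mu h) => v sv y /=; split=> [[h0 hz]|->].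
  apply/eqP; case: ltngtP => // lt.
    by move/hh: h0; rewrite /= sv ltm// => /(_ erefl).
  have [w /hh] := hz _ lt; rewrite /= sv pm => /(_ erefl).
  by [].
split; first by apply/hh; rewrite /= ?sv // pm.
by move=> z /ltm pz; exists 0; apply/hh; rewrite /= ?sv // (negbTE pz).
Qed.

(** A conditional is a recursion with 0 or 1 rounds: it starts at [g v], and a round replaces this
    by [f v]. *)
Lemma computable_if k b f g : computableb k b -> computable k f ->
  computable k g -> computable k (fun v => if b v then f v else g v).
Proof.
move=> hb hf hg.
have hf' : computable k.+2 (fun u => f (behead (behead u))).
  exact: (computable_behead (computable_behead hf)).
apply: computable_ext (computable_rec (s := fun _ _ v => f v) hb hg hf') => v.
by case: (b v).
Qed.

Lemma computableb_ext k (f g : seq nat -> bool) :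
  f =1 g -> computableb k f -> computableb k g.
Proof. by move=> /funext ->. Qed.

Lemma computableb_const k b : computableb k (fun=> b).
Proof. exact: computable_const. Qed.

Lemma computableb_if k b f g : computableb k b -> computableb k f ->
  computableb k g -> computableb k (fun v => if b v then f v else g v).
Proof.
move=> hb hf hg; apply: computable_ext (computable_if hb hf hg) => v.
by case: ifP.
Qed.

Lemma computableb_neg k b : computableb k b -> computableb k (fun v => ~~ b v).
Proof.
move=> hb; apply: computableb_ext
  (computableb_if hb (computableb_const k false) (computableb_const k true)) => v.
by case: (b v).
Qed.

Lemma computableb_and k b c : computableb k b -> computableb k c ->
  computableb k (fun v => b v && c v).
Proof. by move=> hb hc; apply: (computableb_if hb hc (computableb_const k false)). Qed.

Lemma computableb_or k b c : computableb k b -> computableb k c ->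
  computableb k (fun v => b v || c v).
Proof. by move=> hb hc; apply: (computableb_if hb (computableb_const k true) hc). Qed.

Lemma computable_pred k f : computable k f -> computable k (fun v => (f v).-1).
Proof.
move=> hf; apply: computable_ext (computable_rec (s := fun i _ _ => i) hf
  (computable_const k 0) (computable_nth _ 0)) => v.
by case: (f v).
Qed.

Lemma computable_sub k f g : computable k f -> computable k g ->
  computable k (fun v => f v - g v).
Proof.
move=> hf hg; apply: computable_ext (computable_rec (s := fun _ z _ => z.-1) hg
  hf (computable_pred (computable_nth _ 1))) => v.
by elim: (g v) => [|n /= ->]; rewrite ?subn0 ?subnS.
Qed.

Lemma computableb_is0 k f : computable k f -> computableb k (fun v => f v == 0).
Proof.
move=> hf; apply: computable_ext (computable_rec (s := fun _ _ _ => 0) hf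
  (computable_const k 1) (computable_const _ 0)) => v.
by case: (f v).
Qed.

Lemma computableb_leq k f g : computable k f -> computable k g ->
  computableb k (fun v => f v <= g v).
Proof. by move=> hf hg; apply/computableb_is0/computable_sub. Qed.

Lemma computableb_eq k f g : computable k f -> computable k g ->
  computableb k (fun v => f v == g v).
Proof.
move=> hf hg; apply: computableb_ext (computableb_and (computableb_leq hf hg)
  (computableb_leq hg hf)) => v; by rewrite eqn_leq.
Qed.

Lemma computableb_has k n (p : nat -> seq nat -> bool) : computable k n ->
  computableb k.+1 (fun u => p (nth 0 u 0) (behead u)) ->
  computableb k (fun v => has (p ^~ v) (iota 0 (n v))).
Proof.
move=> hn hp.
(* In the recursion the accumulator sits between the counter and the parameters and has to be
   skipped. *)
have hp' : computableb k.+2 (fun u => p (nth 0 u 0) (behead (behead u))).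
  apply: (computable_args (k := k.+2) (m := k.+1)
    (g := fun i v => nth 0 v (if i is j.+1 then j.+2 else 0))
    (w := fun v => nth 0 v 0 :: behead (behead v)) _ _ _ hp).
  - by move=> [|a [|b v]] //= [->].
  - by move=> v [|i] _ //=; rewrite !nth_behead.
  - by move=> i _; exact: computable_nth.
apply: computable_ext (computable_rec
  (s := fun i z v => (z != 0) || p i v : nat) hn
  (computable_const k 0) _) => [v|]; last first.
  apply: computableb_or hp'; apply/computableb_neg/computableb_is0.
  exact: computable_nth.
elim: (n v) => [//|m IH].
by rewrite -[in RHS]addn1 iotaD has_cat /= IH orbF add0n; case: has.
Qed.

Lemma computableb_all k n (p : nat -> seq nat -> bool) : computable k n ->
  computableb k.+1 (fun u => p (nth 0 u 0) (behead u)) ->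
  computableb k (fun v => all (p ^~ v) (iota 0 (n v))).
Proof.
move=> hn hp; apply: computableb_ext (computableb_neg
  (computableb_has (p := fun i v => ~~ p i v) hn (computableb_neg hp))) => v.
by rewrite -all_predC; apply: eq_all => i /=; rewrite negbK.
Qed.

Lemma computable_iter k (h : nat -> nat) n b : R1 h ->
  computable k n -> computable k b ->
  computable k (fun v => iter (n v) h (b v)).
Proof.
move=> hh hn hb; apply: computable_ext (computable_rec
  (s := fun _ z _ => h z) hn hb (computable_comp1 hh (computable_nth _ 1))) => v.
by elim: (n v) => //= m ->.
Qed.

(** * A universal machine *)

(** Induction that also reaches the codes in the list under [Comp], by an inner induction on that
    list. *)
Lemma code_ind_nested (Q : code -> Prop) :
  Q Zero -> Q Succ -> (forall i, Q (Proj i)) ->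
  (forall f gs, Q f -> foldr (fun g => and (Q g)) True gs -> Q (Comp f gs)) ->
  (forall g h, Q g -> Q h -> Q (Prec g h)) -> (forall f, Q f -> Q (Mu f)) ->
  forall c, Q c.
Proof.
move=> hZ hS hP hC hR hM; fix IH 1; case=> [||i|f gs|g h|f].
- exact: hZ.
- exact: hS.
- exact: hP.
- by apply: hC; [exact: IH|elim: gs => //= g gs IHgs; split].
- by apply: hR; exact: IH.
- by apply: hM; exact: IH.
Qed.

(** * Projections of the pairing function *)

Section Pairing.
Variables (pr : nat -> nat -> nat) (hpr : pairing pr).

(** The default is never reached, since [pr] is surjective. *)
Definition unpair z := xget (0, 0) [set p | pr p.1 p.2 = z].
Definition lproj z := (unpair z).1.
Definition rproj z := (unpair z).2.

Lemma pr_lproj_rproj z : pr (lproj z) (rproj z) = z.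
Proof.
rewrite /lproj /rproj /unpair; case: xgetP => [p _ //|nex].
by have [_ [g _ gK] _] := hpr; case: (nex (g z)); exact: gK.
Qed.

Lemma unpair_pr x y : unpair (pr x y) = (x, y).
Proof.
have [_ /bij_inj inj _] := hpr.
apply: (inj (unpair _) (x, y)); exact: pr_lproj_rproj.
Qed.

Lemma lproj_pr x y : lproj (pr x y) = x. Proof. by rewrite /lproj unpair_pr. Qed.
Lemma rproj_pr x y : rproj (pr x y) = y. Proof. by rewrite /rproj unpair_pr. Qed.
Definition prK := (lproj_pr, rproj_pr).

Lemma lproj_le z : lproj z <= z.
Proof.
by have [_ _ /(_ (lproj z) (rproj z)) []] := hpr; rewrite pr_lproj_rproj.
Qed.

Lemma rproj_le z : rproj z <= z.
Proof.
by have [_ _ /(_ (lproj z) (rproj z)) []] := hpr; rewrite pr_lproj_rproj.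
Qed.

Lemma lproj0 : lproj 0 = 0. Proof. by have := lproj_le 0; case: lproj. Qed.
Lemma rproj0 : rproj 0 = 0. Proof. by have := rproj_le 0; case: rproj. Qed.

(** The bounds on the components force 0 to code the pair of zeros. Hence an instruction with
    nonzero tag, or a frame with nonzero code, is never 0. *)
Lemma pr_eq0 x y : (pr x y == 0) = (x == 0) && (y == 0).
Proof.
apply/eqP/andP => [e|[/eqP -> /eqP ->]]; last first.
  by have := pr_lproj_rproj 0; rewrite lproj0 rproj0.
by rewrite -[x](lproj_pr x y) -{2}[y](rproj_pr x y) e lproj0 rproj0.
Qed.

Lemma computable_pr k f g : computable k f -> computable k g ->
  computable k (fun v => pr (f v) (g v)).
Proof.
move=> hf hg; apply: (computable_comp2 (h := pr)) => //.
by have [hpr2 _ _] := hpr; apply/total_computableE.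
Qed.

Lemma computable_lproj k f : computable k f -> computable k (fun v => lproj (f v)).
Proof.
move=> hf; apply: computable_comp1 hf; apply/R1E.
(* The second component is at most the pair itself, so the search for it is bounded. *)
pose p x (v : seq nat) :=
  has (fun y => pr x y == nth 0 v 0) (iota 0 (nth 0 v 0).+1).
apply: (@computable_mu 1 p) => [|v|v z].
- apply: (@computableb_has _ _
    (fun y u => pr (nth 0 u 0) y == nth 0 (behead u) 0)).
    by apply/computable_succ/computable_nth_behead.
  apply: computableb_eq; last exact: computable_nth_behead2.
  by apply: computable_pr; [exact: computable_nth_behead|exact: computable_nth].
- apply/hasP; exists (rproj (nth 0 v 0)); last by rewrite pr_lproj_rproj.
  by rewrite mem_iota ltnS rproj_le.
- by apply: contraL => /hasP[y _ /eqP <-]; rewrite lproj_pr ltnn.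
Qed.

Lemma computable_rproj k f : computable k f -> computable k (fun v => rproj (f v)).
Proof.
move=> hf; apply: computable_comp1 hf; apply/R1E.
pose p y (v : seq nat) := pr (lproj (nth 0 v 0)) y == nth 0 v 0.
apply: (@computable_mu 1 p) => [|v|v z].
- apply: computableb_eq; last exact: computable_nth_behead.
  by apply: computable_pr; [apply: computable_lproj; exact: computable_nth_behead|
    exact: computable_nth].
- by rewrite /p pr_lproj_rproj.
- by apply: contraL => /eqP <-; rewrite rproj_pr ltnn.
Qed.

End Pairing.

Ltac computability := repeat first
  [ simple apply computable_const | simple apply computable_nth
  | simple apply computable_nth_behead | simple apply computable_nth_behead2
  | simple apply computableb_const
  | simple apply computableb_and | simple apply computableb_or
  | simple apply computableb_neg | simple apply computableb_is0
  | simple apply computableb_eq | simple apply computableb_leq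
  | simple apply computableb_if | simple apply computable_if
  | simple apply computable_succ | simple apply computable_pred
  | simple apply computable_sub
  | (simple eapply computable_pr; [eassumption| |])
  | (simple eapply computable_lproj; [eassumption|])
  | (simple eapply computable_rproj; [eassumption|]) ].

(** * A stack machine simulating the codes *)

Section Machine.
Variables (pr : nat -> nat -> nat) (hpr : pairing pr).
Notation lproj := (lproj pr).
Notation rproj := (rproj pr).

Definition state c v K := pr c (pr v K).

(* A state consists of the code to run, the current value and a continuation
   stack; code 0 returns the value to the stack. A frame [pr q w] resumes the
   code [q] at [pr y w], where [y] is the value returned; its code is never 0,
   so the stack 0 is the empty one. The nat [env v] codes the list [v] as a stream
   padded with zeros. *)
Definition step s :=
  let c := lproj s in let v := lproj (rproj s) in let K := rproj (rproj s) in
  let a := rproj c in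
  if c == 0 then
    if K == 0 then s else state (lproj (lproj K)) (pr v (rproj (lproj K))) (rproj K)
  else if lproj c == 1 then state 0 (lproj v).+1 K
  else if lproj c == 2 then state 0 0 K
  else if lproj c == 3 then state 0 (lproj v) K
  else if lproj c == 4 then state 0 (pr (lproj v) (lproj (rproj v))) K
  else if lproj c == 5 then state a (lproj v) K
  else if lproj c == 6 then state a (rproj v) K
  else if lproj c == 7 then state (lproj a) v (pr (pr (rproj a) v) K)
  else if lproj c == 8 then
    if lproj (rproj v) == lproj (rproj (rproj v)) then state 0 (lproj v) K
    else state a (pr (lproj (rproj v)) (pr (lproj v) (rproj (rproj (rproj v)))))
           (pr (pr c (pr (lproj (rproj v)).+1 (rproj (rproj v)))) K)
  else if lproj c == 9 then
    if lproj v == 0 then state 0 (lproj (rproj v)).-1 K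
    else state a (rproj v)
           (pr (pr c (pr (lproj (rproj v)).+1 (rproj (rproj v)))) K)
  else state a (pr (lproj v) (pr 0 (rproj v))) K.

Lemma R1_step : R1 step.
Proof. by apply/R1E; rewrite /step /state /=; computability. Qed.

Definition mSucc := pr 1 0.
Definition mZero := pr 2 0.
Definition mHd := pr 3 0.
Definition mCons := pr 4 0.
Definition mAtHd a := pr 5 a.
Definition mAtTl a := pr 6 a.
Definition mLet p q := pr 7 (pr p q).
(* [mRec h] expects [pr z (pr i v)] with [z] the value after [i] rounds; [mMu f]
   expects [pr w (pr i v)] with [w] the value of [f] at [i.-1]. [mStart] enters
   either loop with [i = 0]. *)
Definition mRec h := pr 8 h.
Definition mMu f := pr 9 f.
Definition mStart a := pr 10 a.

(** [mLet] keeps the environment below the value just computed. For [Comp] the list of values is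
    built from its end, each [tr g] running on the saved environment. For [Mu] the loop starts with
    the dummy value 1, which is nonzero and so cannot stop it. *)
Fixpoint tr (c : code) : nat :=
  match c with
  | Zero => mZero
  | Succ => mSucc
  | Proj i => iter i mAtTl mHd
  | Comp f gs =>
      mLet (foldr (fun g l => mLet l (mLet (mAtTl (tr g)) mCons)) mZero gs)
           (mAtHd (tr f))
  | Prec g h => mLet (mAtTl (tr g)) (mStart (mRec (tr h)))
  | Mu f => mLet (mLet mZero mSucc) (mStart (mMu (tr f)))
  end.

Definition env (v : seq nat) := foldr pr 0 v.

Lemma lproj_env v : lproj (env v) = nth 0 v 0.
Proof. by case: v => [|x v]; rewrite /env /= ?lproj0 ?prK. Qed.

Lemma rproj_env v : rproj (env v) = env (behead v).
Proof. by case: v => [|x v]; rewrite /env /= ?rproj0 ?prK. Qed.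

Definition reach s t := exists n, iter n step s = t.

Lemma reach_trans s t u : reach s t -> reach t u -> reach s u.
Proof. by move=> [m <-] [n <-]; exists (n + m); rewrite iterD. Qed.

Lemma reach_step s t : reach (step s) t -> reach s t.
Proof. by apply: reach_trans; exists 1. Qed.

(** Quantifying over all stacks makes runs composable: a subprogram leaves the frames below it
    untouched. *)
Definition runs p v y := forall K, reach (state p v K) (state 0 y K).

Ltac run_step :=
  rewrite /step /state ?/mSucc ?/mZero ?/mHd ?/mCons ?/mAtHd ?/mAtTl ?/mLet;
  rewrite ?/mRec ?/mMu ?/mStart !(prK hpr); rewrite ?(pr_eq0 hpr) //=.

Lemma return_to q v y z K : q != 0 -> runs q (pr y v) z ->
  reach (state 0 y (pr (pr q v) K)) (state 0 z K).
Proof.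
move=> q0 hq; apply: reach_step; run_step.
by rewrite (negbTE q0) /=; exact: hq.
Qed.

Lemma runs_let p q v y z : q != 0 ->
  runs p v y -> runs q (pr y v) z -> runs (mLet p q) v z.
Proof.
move=> q0 hp hq K; apply: reach_step.
have -> : step (state (mLet p q) v K) = state p v (pr (pr q v) K).
  by run_step.
exact: reach_trans (hp _) (return_to _ q0 hq).
Qed.

Lemma runs_succ v : runs mSucc v (lproj v).+1.
Proof. by move=> K; exists 1; rewrite /=; run_step. Qed.

Lemma runs_zero v : runs mZero v 0.
Proof. by move=> K; exists 1; rewrite /=; run_step. Qed.

Lemma runs_hd v : runs mHd v (lproj v).
Proof. by move=> K; exists 1; rewrite /=; run_step. Qed.

Lemma runs_cons v : runs mCons v (pr (lproj v) (lproj (rproj v))).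
Proof. by move=> K; exists 1; rewrite /=; run_step. Qed.

Lemma runs_atHd a v y : runs a (lproj v) y -> runs (mAtHd a) v y.
Proof. by move=> ha K; apply: reach_step; run_step; exact: ha. Qed.

Lemma runs_atTl a v y : runs a (rproj v) y -> runs (mAtTl a) v y.
Proof. by move=> ha K; apply: reach_step; run_step; exact: ha. Qed.

Lemma runs_start a v y :
  runs a (pr (lproj v) (pr 0 (rproj v))) y -> runs (mStart a) v y.
Proof. by move=> ha K; apply: reach_step; run_step; exact: ha. Qed.

Lemma runs_rec_done h z v : runs (mRec h) (pr z (pr (lproj v) v)) z.
Proof. by move=> K; exists 1; rewrite /=; run_step; rewrite eqxx. Qed.

Lemma runs_rec_step h z i v y w : i != lproj v ->
  runs h (pr i (pr z (rproj v))) y -> runs (mRec h) (pr y (pr i.+1 v)) w ->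
  runs (mRec h) (pr z (pr i v)) w.
Proof.
move=> iv hh hr K; apply: reach_step; run_step; rewrite (negbTE iv).
apply: reach_trans (hh _) (return_to _ _ hr).
by rewrite (pr_eq0 hpr).
Qed.

Lemma runs_mu_done f i v : runs (mMu f) (pr 0 (pr i v)) i.-1.
Proof. by move=> K; exists 1; rewrite /=; run_step. Qed.

Lemma runs_mu_step f w i v y z :
  runs f (pr i v) y -> runs (mMu f) (pr y (pr i.+1 v)) z ->
  runs (mMu f) (pr w.+1 (pr i v)) z.
Proof.
move=> hf hr K; apply: reach_step; run_step.
apply: reach_trans (hf _) (return_to _ _ hr).
by rewrite (pr_eq0 hpr).
Qed.

Lemma eval_runs c v y : eval c v y -> runs (tr c) (env v) y.
Proof.
elim/code_ind_nested: c v y => [||i|f gs IHf IHgs|g h IHg IHh|f IHf] v y /=.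
- by move=> ->; exact: runs_zero.
- by move=> ->; rewrite -lproj_env; exact: runs_succ.
- move=> ->; elim: i v => [|i IH] v /=.
    by rewrite -lproj_env; exact: runs_hd.
  by apply: runs_atTl; rewrite rproj_env -nth_behead; exact: IH.
- move=> [ws hws hf]; apply: (@runs_let _ _ _ (env ws)); rewrite ?(pr_eq0 hpr)//.
    elim: gs ws IHgs hws {hf} => [|g gs IH] [|w ws] //=.
    - by move=> _ _; exact: runs_zero.
    move=> [IHg IHgs] [hg hws].
    apply: (@runs_let _ _ _ (env ws)); rewrite ?(pr_eq0 hpr)//.
      exact: IH.
    apply: (@runs_let _ _ _ w); rewrite ?(pr_eq0 hpr)//.
      by apply: runs_atTl; rewrite rproj_pr//; exact: IHg.
    have := runs_cons (pr w (pr (env ws) (env v))).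
    by rewrite rproj_pr// !lproj_pr.
  by apply: runs_atHd; rewrite lproj_pr//; exact: IHf.
- pose P := fix prec n y {struct n} : Prop :=
    if n is n'.+1 then
      exists2 z, prec n' z & eval h (n' :: z :: behead v) y
    else eval g (behead v) y.
  (* Rounds are peeled off from the end: if the loop entered at round [n] with the correct value [z]
     yields [y], so does the whole program. This is then applied at the last round. *)
  rewrite -/P => hP; have hr n z : n <= nth 0 v 0 -> P n z ->
      runs (mRec (tr h)) (pr z (pr n (env v))) y ->
      runs (tr (Prec g h)) (env v) y.
    elim: n z => [|n IH] z /= nv.
      move=> hg hr; apply: (@runs_let _ _ _ z); rewrite ?(pr_eq0 hpr)//.
        by apply: runs_atTl; rewrite rproj_env; exact: IHg.
      by apply: runs_start; rewrite !(prK hpr).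
    move=> [w hw hz] hr; apply: (IH w) => //; first exact: ltnW.
    apply: runs_rec_step hr; first by rewrite lproj_env ltn_eqF.
    by rewrite rproj_env; exact: IHh hz.
  apply: hr (leqnn _) hP _; rewrite -lproj_env; exact: runs_rec_done.
- move=> [f0 fz]; apply: (@runs_let _ _ _ 1); rewrite ?(pr_eq0 hpr)//.
    apply: (@runs_let _ _ _ 0); rewrite ?(pr_eq0 hpr)//; first exact: runs_zero.
    by have := runs_succ (pr 0 (env v)); rewrite lproj_pr.
  apply: runs_start; rewrite !(prK hpr)//.
  (* Induction on the distance [n] to the least zero [y]; any nonzero previous value keeps the loop
     going. *)
  suff H n : n <= y -> forall w, runs (mMu (tr f)) (pr w.+1 (pr (y - n) (env v))) y.
    by have := H y (leqnn y) 0; rewrite subnn.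
  elim: n => [_|n IH ny] w.
    rewrite subn0; apply: runs_mu_step; first exact: IHf f0.
    exact: runs_mu_done.
  have [|u hu] := fz (y - n.+1); first by rewrite ltn_subrL; case: (y) ny.
  apply: runs_mu_step; first exact: IHf hu.
  by rewrite subnSK//; apply: IH; exact: ltnW.
Qed.

(** Step-bounded computation: final states have code 0 and empty stack. Every number [e] counts as a
    program. *)
Definition phi e x s :=
  let t := iter s step (state e (pr x 0) 0) in
  if (lproj t == 0) && (rproj (rproj t) == 0) then (lproj (rproj t)).+1 else 0.

Lemma computable_phi k e x s : computable k e -> computable k x ->
  computable k s -> computable k (fun v => phi (e v) (x v) (s v)).
Proof.
move=> he hx hs.
have ht : computable k (fun v => iter (s v) step (state (e v) (pr (x v) 0) 0)).
  apply: computable_iter => //; first exact: R1_step.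
  by rewrite /state; computability.
by rewrite /phi /=; computability.
Qed.

Lemma phi_mono e x s t : s <= t -> phi e x s != 0 -> phi e x t = phi e x s.
Proof.
move/subnK => <-; elim: (t - s) => // n IH h; rewrite addSn -[RHS]IH//.
have := h; rewrite -IH// /phi iterS; set u := iter _ _ _; move=> /= hu.
(* Final states are fixed points of [step]. *)
suff -> : step u = u by [].
by case: andP hu => // -[u0 K0] _; rewrite /step u0 K0.
Qed.

Lemma phi_consistent e x s t : phi e x s != 0 -> phi e x t != 0 ->
  phi e x s = phi e x t.
Proof.
by move=> hs ht; case: (leqP s t) => [|/ltnW] /phi_mono ->.
Qed.

Lemma phi_complete f : R1 f -> exists e, forall x, exists s, phi e x s = (f x).+1.
Proof.
move=> /R1E[c hc]; exists (tr c) => x.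
have /eval_runs /(_ 0) [s hs] : eval c [:: x] (f x) by apply/hc.
by exists s; rewrite /phi hs /state !(prK hpr).
Qed.

End Machine.

(** * Numberings indexed by decidable sets *)

Lemma computable_search k (p : nat -> seq nat -> bool) :
  computableb k.+1 (fun u => p (nth 0 u 0) (behead u)) ->
  (forall v, exists z, p z v) ->
  exists2 m, computable k m & forall v, p (m v) v.
Proof.
move=> hp ex; exists (fun v => ex_minn (ex v)); last by move=> v; case: ex_minnP.
apply: computable_mu hp _ _ => v; first by case: ex_minnP.
move=> z; case: ex_minnP => m _ min; apply: contraL => /min.
by rewrite leqNgt.
Qed.

(* A stage function codes "no value yet" by 0 and "value y" by y + 1. *)
Definition limit (b : nat -> nat) : option nat :=
  if `[< exists s, b s != 0 >] then Some (b (xget 0 [set s | b s != 0])).-1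
  else None.

Definition consistent (b : nat -> nat) :=
  forall s t, b s != 0 -> b t != 0 -> b s = b t.

Lemma limit_None b : limit b = None <-> forall s, b s = 0.
Proof.
rewrite /limit; case: asboolP => [[s bs]|nex]; split=> //.
  by move=> b0; rewrite b0 in bs.
by move=> _ s; apply/eqP/negPn/negP => bs; apply: nex; exists s.
Qed.

Lemma limit_Some b y : consistent b -> limit b = Some y <-> exists s, b s = y.+1.
Proof.
move=> cb; rewrite /limit; case: asboolP => [ex|nex]; last first.
  by split=> // -[s bs]; case: nex; exists s; rewrite bs.
case: xgetP => [s _ /= bs|nex]; last by case: ex => s /nex.
split=> [[<-]|[t bt]]; first by exists s; rewrite prednK// lt0n.
by rewrite (cb s t)// bt.
Qed.

Section Limits.
Variables (pr : nat -> nat -> nat) (hpr : pairing pr).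
Variable B : nat -> nat -> nat -> nat.
Hypothesis cB : computable 3 (fun v => B (nth 0 v 0) (nth 0 v 1) (nth 0 v 2)).
Hypothesis consB : forall i x, consistent (B i x).

Lemma QGN1_limit : QGN1 pr (fun i x => limit (B i x)).
Proof.
(* [m] is read as [pr (pr i x) s]. For [s = 0] the element with second component 0 is listed; a
   successor [s] lists the preceding stage, whose shift by one agrees with that of the extended
   graph. A stage without value repeats the element with 0. *)
pose f m := pr (lproj pr m) (if rproj pr m == 0 then 0 else
  B (lproj pr (lproj pr m)) (rproj pr (lproj pr m)) (rproj pr m).-1).
exists f.
  apply/R1E; rewrite /f; apply: computable_pr => //; first by computability.
  apply: computable_if; try by computability.
  by apply: (computable_comp3 cB); computability.
apply/seteqP; split=> [_ [m _ <-]|z].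
  rewrite /f; case: ifPn => [_|m0].
    by left; exists (lproj pr (lproj pr m)), (rproj pr (lproj pr m));
      rewrite pr_lproj_rproj.
  case E: (B _ _ _) => [|y].
    by left; exists (lproj pr (lproj pr m)), (rproj pr (lproj pr m));
      rewrite pr_lproj_rproj.
  right; exists (lproj pr (lproj pr m)), (rproj pr (lproj pr m)), y.
  by rewrite pr_lproj_rproj//; split=> //; apply/limit_Some => //; exists (rproj pr m).-1.
case=> [[i [x ->]]|[i [x [y [/limit_Some h ->]]]]].
  by exists (pr (pr i x) 0) => //; rewrite /f !(prK hpr).
have [//|s bs] := h.
by exists (pr (pr i x) s.+1) => //; rewrite /f !(prK hpr)/= bs.
Qed.

Lemma R1_limit i f : (forall x, limit (B i x) = Some (f x)) -> R1 f.
Proof.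
move=> hf.
have [||m hm Bm] := @computable_search 1 (fun s v => B i (nth 0 v 0) s != 0).
- apply/computableb_neg/computableb_is0/(computable_comp3 cB); computability.
- move=> v; have /limit_Some [//|s bs] := hf (nth 0 v 0).
  by exists s; rewrite bs.
apply/R1E.
apply: (@computable_ext _ (fun v => (B i (nth 0 v 0) (m v)).-1)) => [v|].
  have /limit_Some [//|s bs] := hf (nth 0 v 0).
  by rewrite (consB (Bm v) (t := s)) bs.
by apply/computable_pred/(computable_comp3 cB) => //; computability.
Qed.

End Limits.

(** Finite tables padded with zeros; they extend functions on a segment to total computable ones. *)
Lemma R1_nth (s : seq nat) : R1 (nth 0 s).
Proof.
elim: s => [|y s IH]; apply/R1E.
  by apply: (computable_ext (f := fun=> 0)) => [v|];
    [rewrite nth_nil|exact: computable_const].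
apply: (@computable_ext _
  (fun v => if nth 0 v 0 == 0 then y else nth 0 s (nth 0 v 0).-1)) => [v|].
  by case: (nth 0 v 0).
by apply: computable_if; [computability..|apply: computable_comp1 => //; computability].
Qed.

(** * A computable numbering of the nonempty functions *)

Section Segments.
Variables (pr : nat -> nat -> nat) (hpr : pairing pr).
Variables (a : nat -> nat) (a1 : R1 a).
Notation lproj := (lproj pr).
Notation rproj := (rproj pr).
Notation phi := (phi pr).

(* [b = 0] leaves the domain of [phi e] unrestricted, [b = n.+1] only allows
   the domain [`I_(a n)]. *)
Definition allowed b n := (b == 0) || (b == n.+1).

(** A value at [x] is released only after convergence on a whole segment around [x] with length in
    the range of [a]. The limit domain is a union of such segments, hence empty, one of them, or all
    of nat. *)
Definition settled e b x s :=
  has (fun n => [&& allowed b n, x < a n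
      & all (fun z => phi e z s != 0) (iota 0 (a n))]) (iota 0 s).

Definition alpha e b x s := if settled e b x s then phi e x s else 0.

(** In an index [pr (pr e b) k] the stage [k] is a certificate that the function is defined at 0. If
    it fails, the index names the constant 0 (1 codes the value 0), so no index names the empty
    function. *)
Definition beta i x s :=
  if settled (lproj (lproj i)) (rproj (lproj i)) 0 (rproj i)
  then alpha (lproj (lproj i)) (rproj (lproj i)) x s else 1.

Lemma computable_settled : computableb 4
  (fun v => settled (nth 0 v 0) (nth 0 v 1) (nth 0 v 2) (nth 0 v 3)).
Proof.
apply: (@computableb_has 4 _ (fun n v => [&& allowed (nth 0 v 1) n,
  nth 0 v 2 < a n & all (fun z => phi (nth 0 v 0) z (nth 0 v 3) != 0)
                        (iota 0 (a n))])); first by computability.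
have ca k : computable k (fun v => a (nth 0 v 0)).
  by apply: computable_comp1 => //; computability.
apply/computableb_and; first by rewrite /allowed; computability.
apply/computableb_and; first by computability.
apply: (@computableb_all 5 _ (fun z v => phi (nth 0 (behead v) 0) z
  (nth 0 (behead v) 3) != 0)) => //.
by apply/computableb_neg/computableb_is0/computable_phi => //; computability.
Qed.

Lemma computable_alpha k e b x s : computable k e -> computable k b ->
  computable k x -> computable k s ->
  computable k (fun v => alpha (e v) (b v) (x v) (s v)).
Proof.
move=> he hb hx hs; apply: computable_if; last by computability.
  exact: (computable_comp4 (h := settled) computable_settled).
exact: computable_phi.
Qed.

Lemma computable_beta k i x s : computable k i -> computable k x ->
  computable k s -> computable k (fun v => beta (i v) (x v) (s v)).
Proof.
move=> hi hx hs; apply: computable_if; last by computability.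
  by apply: (computable_comp4 (h := settled) computable_settled); computability.
by apply: computable_alpha => //; computability.
Qed.

Lemma alpha_neq0 e b x s : alpha e b x s != 0 ->
  settled e b x s /\ alpha e b x s = phi e x s.
Proof. by rewrite /alpha; case: settled. Qed.

Lemma alpha_consistent e b x : consistent (alpha e b x).
Proof.
move=> s t hs ht; have [_ es] := alpha_neq0 hs; have [_ et] := alpha_neq0 ht.
by rewrite es et; apply: phi_consistent; rewrite -?es -?et.
Qed.

Lemma beta_consistent i x : consistent (beta i x).
Proof. by rewrite /beta; case: settled => //; exact: alpha_consistent. Qed.

Definition good e b n :=
  allowed b n /\ forall z, z < a n -> exists s, phi e z s != 0.

Lemma good_settled e b n x : good e b n -> x < a n -> exists s, settled e b x s.
Proof.
move=> [bn conv] xn.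
(* Finitely many arguments converge by a common stage. *)
have [s hs] : exists s, forall z, z < a n -> phi e z s != 0.
  elim: (a n) conv => [|m IH] conv; first by exists 0.
  have [s hs] := IH (fun z zm => conv z (ltnW zm)); have [t ht] := conv m (leqnn _).
  exists (maxn s t) => z; rewrite ltnS leq_eqVlt => /predU1P[->|/hs h].
    by rewrite (phi_mono _ ht)// leq_maxr.
  by rewrite (phi_mono _ h)// leq_maxl.
(* The stage must also exceed [n], since [settled] only inspects indices below it. *)
exists (maxn s n.+1); apply/hasP; exists n.
  by rewrite mem_iota leq_max ltnSn orbT.
rewrite bn xn; apply/allP => z; rewrite mem_iota => /hs h.
by rewrite (phi_mono _ h)// leq_maxl.
Qed.

Lemma settled_good e b x s : settled e b x s ->
  phi e x s != 0 /\ exists2 n, good e b n & x < a n.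
Proof.
move=> /hasP[n _ /and3P[bn xn /allP conv]]; split.
  by apply: conv; rewrite mem_iota.
by exists n => //; split=> // z zn; exists s; apply: conv; rewrite mem_iota.
Qed.

Lemma limit_alpha_neqNone e b x : limit (alpha e b x) <> None <->
  exists2 n, good e b n & x < a n.
Proof.
split=> [h|[n gn xn] /limit_None h].
  apply: contra_notP h => h; apply/limit_None => s.
  apply/eqP/negPn/negP => /alpha_neq0 [/settled_good [_ ex] _].
  exact: h.
have [s ss] := good_settled gn xn; have := h s.
by rewrite /alpha ss; have [/eqP] := settled_good ss.
Qed.

Lemma limit_alphaE e b f x : (forall x, exists s, phi e x s = (f x).+1) ->
  (exists2 n, allowed b n & x < a n) -> limit (alpha e b x) = Some (f x).
Proof.
move=> hf [n bn xn].
have [|s ss] := @good_settled e b n x _ xn.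
  by split=> // z _; have [s e0] := hf z; exists s; rewrite e0.
apply/limit_Some; first exact: alpha_consistent.
exists s; rewrite /alpha ss; have [hs _] := settled_good ss; have [t ht] := hf x.
by rewrite (phi_consistent hs (t := t)) ht.
Qed.

(** If the good segments cover nat, the function is total and hence computable. Otherwise their
    lengths are bounded, and the domain is the longest one, or empty if there is none. *)
Lemma limit_alpha_S1 e b : S1 (range a) (fun x => limit (alpha e b x)).
Proof.
have [tot|] := pselect (forall x, exists2 n, good e b n & x < a n).
  left; exists (fun x => odflt 0 (limit (alpha e b x))).
    apply: (@R1_limit (fun _ x s => alpha e b x s) _ _ 0) => [||x].
    - by apply: computable_alpha; computability.
    - by move=> _ x; exact: alpha_consistent.
    - by have /limit_alpha_neqNone := tot x; case: limit.
  apply/funext => x; have /limit_alpha_neqNone := tot x; by case: limit.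
move=> /existsNP[x0 nx0]; right.
have bnd n : good e b n -> a n <= x0.
  by move=> gn; rewrite leqNgt; apply/negP => xn; apply: nx0; exists n.
have [ex|nex] := pselect (exists m, `[< exists2 n, good e b n & a n = m >]).
  have {}bnd m : `[< exists2 n, good e b n & a n = m >] -> m <= x0.
    by move=> /asboolP[n gn <-]; exact: bnd.
  have [m /asboolP[n gn <-{m}] max] := ex_maxnP ex bnd.
  right; exists (a n); first by exists n.
  apply/seteqP; split=> [x /limit_alpha_neqNone[m gm xm]|x xn] /=.
    by apply: leq_trans xm _; apply: max; apply/asboolP; exists m.
  by apply/limit_alpha_neqNone; exists n.
left; apply/seteqP; split=> // x /limit_alpha_neqNone[n gn _].
by apply: nex; exists (a n); apply/asboolP; exists n.
Qed.

Lemma limit_const1 : limit (fun=> 1) = Some 0.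
Proof. by apply/limit_Some => //; exists 0. Qed.

Lemma limit_beta_S1 i : S1 (range a) (fun x => limit (beta i x)).
Proof.
rewrite /beta; case: settled; first exact: limit_alpha_S1.
left; exists (fun=> 0); last by rewrite limit_const1.
by apply/R1E; exact: computable_const.
Qed.

Lemma limit_beta_neqNone i : limit (beta i 0) <> None.
Proof.
rewrite /beta; case E: settled; last by rewrite limit_const1.
by have [_ ex] := settled_good E; apply/limit_alpha_neqNone.
Qed.

Hypothesis unbounded : forall x, exists n, x < a n.

(** The restriction [b] is 0 for total [g], where unboundedness of [a] gives the last clause. For a
    domain of length [a n] it is [n.+1], and [f] is the table of [g] padded with zeros. *)
Lemma S1_extension g : S1 (range a) g -> (exists x, g x <> None) ->
  exists f b, [/\ R1 f,
    forall x n, allowed b n -> x < a n -> g x = Some (f x)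
    & forall x, g x <> None -> exists2 n, allowed b n & x < a n].
Proof.
case=> [[f f1 <-]|[g0|[_ [n _ <-] gn]]] [x0 gx0].
- by exists f, 0; split=> // x _; have [n xn] := unbounded x; exists n.
- by have : dom g x0 by []; rewrite g0.
- exists (nth 0 (mkseq (odflt 0 \o g) (a n))), n.+1; split; first exact: R1_nth.
    move=> x m /eqP[<-] xn; rewrite nth_mkseq//=.
    by have : dom g x by [rewrite gn]; rewrite /dom /=; case: (g x).
  move=> x gx; have xn : x < a n by have : dom g x by []; rewrite gn.
  by exists n => //; rewrite /allowed eqxx.
Qed.

Lemma limit_beta_surj g : S1 (range a) g -> (exists x, g x <> None) ->
  exists i, (fun x => limit (beta i x)) = g.
Proof.
move=> gS gN; have [f [b [f1 gf gdom]]] := S1_extension gS gN.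
have [e ef] := phi_complete hpr f1.
have gd n : allowed b n -> good e b n.
  by move=> bn; split=> // z _; have [s ez] := ef z; exists s; rewrite ez.
have [x0 /gdom[n bn xn]] := gN.
have [k sk] := good_settled (gd _ bn) (leq_ltn_trans (leq0n _) xn).
exists (pr (pr e b) k); apply/funext => x.
rewrite /beta !(prK hpr) sk.
have [[m bm xm]|nex] := pselect (exists2 n, allowed b n & x < a n).
  by rewrite (gf x m)//; apply: limit_alphaE => //; exists m.
transitivity (None : option nat).
  apply: contra_notP nex => /limit_alpha_neqNone[m [bm _] xm].
  by exists m.
by apply: esym; apply: contra_notP nex; exact: gdom.
Qed.

(** As a total function with values 0 and 1, [d] has a [beta] index [j]. If [d j] holds, the value
    at [j] is 1 but should be 0; if not, it is 0 and [d j] should hold. *)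
Lemma diagonal_undecidable (d : nat -> bool) : R1 d ->
  ~ forall j, d j <-> limit (beta j j) = Some 0.
Proof.
move=> d1 dP; have [||j dj] := @limit_beta_surj (fun x => Some (d x : nat)).
- by left; exists (fun x => d x : nat).
- by exists 0.
have := dP j; rewrite (congr1 (@^~ j) dj); case: (d j) => -[].
  by move=> /(_ isT).
by move=> _ /(_ erefl).
Qed.

(** * Joins with numberings of constants *)

Section Sum.

(* Index [pr 0 j] names the [j]-th nonempty function, [pr t.+1 (pr x j)] names
   the constant function [x] if [r x] and [beta j j] has value 0, else the empty
   function. *)
Definition theta (r : nat -> bool) i x s :=
  if lproj i == 0 then beta (rproj i) x s
  else if r (lproj (rproj i)) && (beta (rproj (rproj i)) (rproj (rproj i)) s == 1)
  then (lproj (rproj i)).+1 else 0.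

Definition eta r i x := limit (theta r i x).

Lemma theta_consistent r i x : consistent (theta r i x).
Proof.
rewrite /theta; case: (lproj i == 0); first exact: beta_consistent.
by move=> s t; do 2 case: ifP.
Qed.

Lemma computable_theta (r : nat -> bool) : R1 r -> computable 3
  (fun v => theta r (nth 0 v 0) (nth 0 v 1) (nth 0 v 2)).
Proof.
move=> r1; apply: computable_if; first by computability.
  by apply: computable_beta; computability.
apply: computable_if; [|computability..].
apply: computableb_and.
  by apply: (computable_comp1 (h := r) r1); computability.
by apply: computableb_eq; [apply: computable_beta|]; computability.
Qed.

Lemma eta_beta (r : nat -> bool) i : lproj i = 0 ->
  eta r i = fun x => limit (beta (rproj i) x).
Proof. by move=> i0; rewrite /eta /theta i0. Qed.

Lemma eta_const (r : nat -> bool) i : lproj i != 0 -> r (lproj (rproj i)) ->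
  limit (beta (rproj (rproj i)) (rproj (rproj i))) = Some 0 ->
  eta r i = fun=> Some (lproj (rproj i)).
Proof.
move=> i0 ri /limit_Some [|s bs]; first exact: beta_consistent.
apply/funext => x; apply/limit_Some; first exact: theta_consistent.
by exists s; rewrite /theta (negbTE i0) ri bs.
Qed.

Lemma eta_empty (r : nat -> bool) i : lproj i != 0 ->
  ~ (r (lproj (rproj i)) /\
     limit (beta (rproj (rproj i)) (rproj (rproj i))) = Some 0) ->
  eta r i = fun=> None.
Proof.
move=> i0 nri; apply/funext => x; apply/limit_None => s.
rewrite /theta (negbTE i0); case: ifP => // /andP[ri /eqP bs].
case: nri; split=> //; apply/limit_Some; first exact: beta_consistent.
by exists s.
Qed.

(** Some [j] lies outside the diagonal set, or the constantly true predicate would decide it. A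
    constant-type index built on this [j] is empty whatever [r] is. *)
Lemma eta_has_empty : exists i, forall r : nat -> bool, eta r i = fun=> None.
Proof.
have [j nj] : exists j, limit (beta j j) <> Some 0.
  apply/existsNP => all0; apply: (@diagonal_undecidable xpredT) => //.
  by apply/R1E; exact: computable_const.
exists (pr 1 (pr 0 j)) => r; apply: eta_empty; rewrite !(prK hpr)//.
by case.
Qed.

Lemma eta_BN (r : nat -> bool) : R1 r -> BN pr (range a) (eta r).
Proof.
move=> r1; split; last first.
  by apply: QGN1_limit => //; [exact: computable_theta|exact: theta_consistent].
apply/seteqP; split=> [_ [i _ <-]|g gS].
  have [i0|i0] := eqVneq (lproj i) 0.
    by rewrite eta_beta//; exact: limit_beta_S1.
  have [[ri bi]|nri] := pselect (r (lproj (rproj i)) /\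
      limit (beta (rproj (rproj i)) (rproj (rproj i))) = Some 0).
    rewrite eta_const//; left; exists (fun=> lproj (rproj i)); last by [].
    by apply/R1E; exact: computable_const.
  rewrite eta_empty//; right; left.
  by apply/seteqP; split=> x.
have [gN|gN] := pselect (exists x, g x <> None).
  have [j <-] := limit_beta_surj gS gN; exists (pr 0 j) => //.
  by rewrite eta_beta !(prK hpr).
have [i iE] := eta_has_empty; exists i => //; rewrite iE; apply/funext => x.
by apply/esym; apply: contra_notP gN => gx; exists x.
Qed.

Lemma eta_le (r r' : nat -> bool) : R1 r -> {subset r <= r'} ->
  m_le (eta r) (eta r').
Proof.
move=> r1 rr'; have [i0 i0E] := eta_has_empty.
(* Indices are kept, except those of constants outside [r]: they name the empty function and go to
   its fixed index [i0]. *)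
exists (fun i => if (lproj i == 0) || r (lproj (rproj i)) then i else i0).
  apply/R1E; apply: computable_if; [|computability..].
  apply: computableb_or; first by computability.
  by apply: (computable_comp1 (h := r) r1); computability.
apply/funext => i /=; have [i1|i1] /= := eqVneq (lproj i) 0.
  by rewrite !eta_beta.
case: ifPn => ri; last by rewrite i0E eta_empty// => -[/(negP ri)].
have [bi|bi] := pselect (limit (beta (rproj (rproj i)) (rproj (rproj i))) = Some 0).
  by rewrite !eta_const//; exact: rr'.
by rewrite !eta_empty// => -[].
Qed.

Lemma eta_le_inv (r r' : nat -> bool) : m_le (eta r) (eta r') ->
  {subset r <= r'}.
Proof.
move=> [g g1 gE] x rx; apply/negPn/negP => nr'x.
(* Landing in the [beta] part decides the diagonal set: functions there are nonempty, so [j] is in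
   the set; outside it, the constant [x] cannot occur because [r' x] fails, so [j] is not. *)
apply: (@diagonal_undecidable (fun j => lproj (g (pr 1 (pr x j))) == 0)).
  apply/R1E; apply: computableb_is0; apply: computable_lproj => //.
  by apply: computable_comp1 => //; computability.
move=> j; set i := pr 1 (pr x j).
have giE : eta r i = eta r' (g i) by rewrite gE.
have [g0|g0] := eqVneq (lproj (g i)) 0; split=> //.
  move=> _; apply: contrapT => bj.
  move: giE; rewrite (eta_beta _ g0) eta_empty ?/i ?(prK hpr)//; last by case.
  by move=> /(congr1 (@^~ 0)) /esym /limit_beta_neqNone.
move=> bj; move: giE; rewrite eta_const ?/i ?(prK hpr)//.
move=> /(congr1 (@^~ 0)).
have [[r'g bg]|nr'g] := pselect (r' (lproj (rproj (g i))) /\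
      limit (beta (rproj (rproj (g i))) (rproj (rproj (g i)))) = Some 0).
  by rewrite eta_const// => -[xE]; move: nr'x; rewrite xE unfold_in r'g.
by rewrite eta_empty.
Qed.

End Sum.
End Segments.

(** * Embedding preorders into decidable sets *)

(** The list is fixed in advance, so [p i] need not be computable uniformly in [i]; this
    accommodates an undecidable [le]. *)
Lemma computableb_has_seq k (T : Type) (s : seq T) (p : T -> seq nat -> bool) :
  (forall i, computableb k (p i)) -> computableb k (fun v => has (p ^~ v) s).
Proof.
by move=> hp; elim: s => [|i s IH]; [exact: computableb_const|exact: computableb_or].
Qed.

Lemma computableb_all_seq k (T : Type) (s : seq T) (p : T -> seq nat -> bool) :
  (forall i, computableb k (p i)) -> computableb k (fun v => all (p ^~ v) s).
Proof.
by move=> hp; elim: s => [|i s IH]; [exact: computableb_const|exact: computableb_and].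
Qed.

Section Preorder.
Variables (pr : nat -> nat -> nat) (hpr : pairing pr) (le : rel nat).
Notation lproj := (lproj pr).
Notation rproj := (rproj pr).

Definition bit i x := lproj (iter i rproj x) != 0.

Definition upto l x := all (fun i => all (fun j =>
  [|| ~~ le i j, ~~ bit i x | bit j x]) (iota 0 l.+1)) (iota 0 l.+1).

(* The bits of [x] propose a subset of nat; [cone n] tests membership of [n] in the
   up-set generated by the longest initial part of the proposal that is upward
   closed. Only the bits up to [n] matter, which makes [cone n] decidable even
   if [le] is not. *)
Definition cone n x :=
  has (fun l => [&& upto l x, bit l x & le l n]) (iota 0 n.+1).

Lemma R1_cone n : R1 (fun x => cone n x).
Proof.
have cbit i : computableb 1 (fun v => bit i (nth 0 v 0)).
  apply/computableb_neg/computableb_is0/computable_lproj => //.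
  by elim: i => [|i IH] /=; computability.
apply/R1E; apply: (@computableb_has_seq _ _ _ (fun l v =>
  [&& upto l (nth 0 v 0), bit l (nth 0 v 0) & le l n])) => l.
apply: computableb_and; last by apply: computableb_and => //; computability.
apply: (@computableb_all_seq _ _ _ (fun i v => all (fun j =>
  [|| ~~ le i j, ~~ bit i (nth 0 v 0) | bit j (nth 0 v 0)]) _)) => i.
apply: (@computableb_all_seq _ _ _ (fun j v =>
  [|| ~~ le i j, ~~ bit i (nth 0 v 0) | bit j (nth 0 v 0)])) => j.
by apply: computableb_or; [|apply: computableb_or => //; apply: computableb_neg];
  computability.
Qed.

Lemma bit_env s i : bit i (env pr s) = (nth 0 s i != 0).
Proof.
rewrite /bit; elim: i s => [|i IH] s; first by rewrite /= lproj_env.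
by rewrite iterSr rproj_env// IH nth_behead.
Qed.

Lemma uptoP l x : reflect (forall i j, i <= l -> j <= l -> le i j -> bit i x ->
  bit j x) (upto l x).
Proof.
apply: (iffP allP) => [h i j il jl ij bi|h i].
  have := h i; rewrite mem_iota ltnS => /(_ il) /allP /(_ j).
  by rewrite mem_iota ltnS ij bi => /(_ jl).
rewrite mem_iota => il; apply/allP => j; rewrite mem_iota => jl.
by case ij: (le i j) => //=; case bi: (bit i x) => //=; exact: h bi.
Qed.

Hypotheses (le_refl : reflexive le) (le_trans : transitive le).

Lemma cone_subset n m : le n m <-> {subset cone n <= cone m}.
Proof.
split=> [nm x|sub].
  move=> /hasP[l]; rewrite mem_iota ltnS => ln /and3P[ul bl len].
  have lm := le_trans len nm.
  (* If [l] exceeds [m] it is out of range for [cone m]; but the proposal is upward closed up to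
     [l], so it contains [m], which replaces [l]. *)
  have [lem|/ltnW mle] := leqP l m; apply/hasP.
    by exists l; rewrite ?mem_iota// ul bl.
  exists m; first by rewrite mem_iota ltnSn.
  have /uptoP ul' := ul; rewrite le_refl (ul' l m)// !andbT.
  apply/uptoP => i j im jm; apply: ul'; exact: leq_trans mle.
(* The test proposal is the up-set of [n], cut off after both [n] and [m]. It lies in [cone n], and
   a witness [l] for [cone m] satisfies [le n l] and [le l m]. *)
pose w := env pr (mkseq (fun i => le n i : nat) (maxn n m).+1).
have bE i : i <= maxn n m -> bit i w = le n i.
  by move=> im; rewrite bit_env nth_mkseq//; case: le.
have /sub /hasP[l] : w \in cone n.
  apply/hasP; exists n; first by rewrite mem_iota ltnSn.
  rewrite le_refl bE ?leq_maxl// le_refl !andbT.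
  apply/uptoP => i j il jl ij; rewrite !bE ?leq_max ?il ?jl// => ni.
  exact: le_trans ni ij.
rewrite mem_iota ltnS /= => lm /and3P[_ bl]; apply: le_trans.
by rewrite -bE// leq_max lm orbT.
Qed.

End Preorder.

(** * Embedding a countable partial order *)

Theorem theorem8p12 (pr : nat -> nat -> nat) (hpr : pairing pr)
    (A : set nat) (infA : infinite_set A) (ceA : ce A)
    (d : Order.disp_t) (P : porderType d) (countP : countable [set: P]) :
  exists J : P -> set (nat -> pfun),
    [/\ forall p : P, Rogers pr A (J p),
        injective J
      & forall p q : P, (p <= q)%O <-> class_le (J p) (J q)].
Proof.
case: ceA infA => [-> []|[a a1 <-] infA]; first exact: finite_set0.
have unbounded x : exists n, x < a n.
  apply: contrapT => nex; apply: infA.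
  apply: (@sub_finite_set _ _ `I_x.+1) => [_ [n _ <-]|]; last exact: finite_II.
  by rewrite /= ltnS leqNgt; apply/negP => xn; apply: nex; exists n.
have [c cinj] : exists c : P -> nat, injective c.
  have /countable_injP[c cinj] := countP.
  by exists c => p q; apply: cinj; rewrite inE.
(* The order transported to nat along [c]; the equality disjunct makes it reflexive outside the
   range of [c]. *)
pose le i j := (i == j) ||
  `[< exists p q, [/\ c p = i, c q = j & (p <= q)%O] >].
have leE p q : le (c p) (c q) = (p <= q)%O.
  apply/orP/idP => [[/eqP/cinj -> //|/asboolP[_ [_ [/cinj -> /cinj -> //]]]]|pq].
  by right; apply/asboolP; exists p, q.
have le_refl : reflexive le by move=> i; rewrite /le eqxx.
have le_trans : transitive le.
  move=> j i k /orP[/eqP ->//|/asboolP[p [q [<- <- pq]]]].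
  move=> /orP[/eqP <-|/asboolP[p' [q' [/cinj pE <- pq']]]]; first by rewrite leE.
  by rewrite leE (Order.POrderTheory.le_trans pq)// -pE.
pose e p := eta pr a (cone pr le (c p)).
have eBN p : BN pr (range a) (e p) by apply: eta_BN => //; exact: R1_cone.
exists (fun p => m_class (range a) (e p)).
have classE p q : (p <= q)%O <->
    class_le (m_class (range a) (e p)) (m_class (range a) (e q)).
  have [[np _] [nq _]] := (eBN p, eBN q).
  rewrite -leE (cone_subset hpr le_refl le_trans) (class_leE np nq); split.
    by apply: eta_le => //; exact: R1_cone.
  exact: eta_le_inv.
clearbody e.
split; [by move=> p; exists (e p)|move=> p q pq|exact: classE].
(* Equal classes are comparable in both directions, so antisymmetry in [P] gives injectivity. *)
by apply/Order.POrderTheory.le_anti/andP; split; apply/classE;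
  rewrite pq; apply/classE.
Qed.
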